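(* Suppose $\frac{p\sqrt[4]{n}}{\ln n}\to\infty$ and $q\ln n\to\infty$ as $n\to\infty$, where $q=1-p$. Then for every $\varepsilon>0$ there exists $n_0$ such that for all $n\ge n_0$, both $u_2(n,p)$ and $u_2'(n,p)$ are at least $$\left(2-\varepsilon+\frac{4\ln p}{\ln(np)}\right)\log_{\frac{1}{1-p}}(np).$$
   Context: $G(n,p)$ is the Erdős–Rényi random graph on $n$ labelled vertices (vertex set $V$), each edge present independently with probability $p=p(n)$; $\mathbb{P}_{n,p}$ is the corresponding probability and $q=1-p$. A diameter graph in $\mathbb{R}^d$ is a graph $(V,E)$ with $V\subset\mathbb{R}^d$ finite and $E=\{\{\mathbf{x},\mathbf{y}\}\subseteq V: |\mathbf{x}-\mathbf{y}|=\operatorname{diam}V\}$, where $\operatorname{diam}V=\max_{\mathbf{x},\mathbf{y}\in V}|\mathbf{x}-\mathbf{y}|$ (Euclidean norm); a graph is a diameter graph in $\mathbb{R}^d$ if it is isomorphic to one. $u_d(n,p)$ is the largest positive integer $k$ such that $\mathbb{P}_{n,p}\big(\exists W\subseteq V,\ |W|=k,\ G[W]$ is a diameter graph in $\mathbb{R}^d$ and $\chi(G[W])=d+1\big)>\frac12$, where $G[W]$ is the induced subgraph; if no such $k$ exists, $u_d(n,p)=0$. $u_d'(n,p)$ is defined identically with the additional requirement that $G[W]$ be connected. *)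

(* Defs.v *)
From Stdlib Require Import Reals ClassicalEpsilon.
From mathcomp Require Import all_boot.
Delimit Scope R_scope with R.
Set Implicit Arguments. Unset Strict Implicit. Unset Printing Implicit Defensive.

Definition decb (P : Prop) : bool :=
  if excluded_middle_informative P then true else false.
Definition indR (P : Prop) : R := if excluded_middle_informative P then 1%R else 0%R.

(* A labelled graph on 'I_n is encoded by g : {ffun 'I_n * 'I_n -> bool};
   only the entries g (i,j) with i < j are meaningful. *)
Definition adj (n : nat) (g : {ffun 'I_n * 'I_n -> bool}) (i j : 'I_n) : bool :=
  ((i < j)%N && g (i, j)) || ((j < i)%N && g (j, i)).

(* Probability weight of g in G(n,p): p^{#edges} q^{#non-edges} on canonical
   encodings (g e = false for e.1 >= e.2), and 0 on the others. *)
Definition gnp_weight (n : nat) (p : R) (g : {ffun 'I_n * 'I_n -> bool}) : R :=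
  \big[Rmult/1%R]_(e : 'I_n * 'I_n)
     (if (e.1 < e.2)%N then (if g e then p else (1 - p)%R)
      else (if g e then 0%R else 1%R)).

Definition Pnp (n : nat) (p : R) (E : rel 'I_n -> Prop) : R :=
  \big[Rplus/0%R]_(g : {ffun 'I_n * 'I_n -> bool})
     (gnp_weight p g * indR (E (adj g)))%R.

Definition point (d : nat) := 'I_d -> R.
Definition edist (d : nat) (x y : point d) : R :=
  sqrt (\big[Rplus/0%R]_(i < d) ((x i - y i) * (x i - y i))%R).

Definition is_diameter_graph (d n : nat) (a : rel 'I_n) (W : {set 'I_n}) : Prop :=
  exists f : 'I_n -> point d,
    (forall x y, x \in W -> y \in W -> f x = f y -> x = y) /\
    exists D : R,
      (forall x y, x \in W -> y \in W -> (edist (f x) (f y) <= D)%R) /\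
      (exists x y, x \in W /\ y \in W /\ edist (f x) (f y) = D) /\
      (forall x y, x \in W -> y \in W -> x <> y ->
         (a x y = true <-> edist (f x) (f y) = D)).

Definition colorable (n : nat) (a : rel 'I_n) (W : {set 'I_n}) (k : nat) : Prop :=
  exists c : 'I_n -> nat,
    (forall x, x \in W -> (c x < k)%N) /\
    (forall x y, x \in W -> y \in W -> a x y = true -> c x <> c y).

Definition chromatic_number_is (n : nat) (a : rel 'I_n) (W : {set 'I_n}) (m : nat) : Prop :=
  colorable a W m /\ (forall k, colorable a W k -> (m <= k)%N).

Definition induced_connected (n : nat) (a : rel 'I_n) (W : {set 'I_n}) : Prop :=
  forall x y, x \in W -> y \in W ->
    connect (fun u v => [&& a u v, u \in W & v \in W]) x y.

Definition event_u (d n k : nat) (a : rel 'I_n) : Prop :=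
  exists W : {set 'I_n}, #|W| = k /\ is_diameter_graph d a W /\
                         chromatic_number_is a W d.+1.
Definition event_u' (d n k : nat) (a : rel 'I_n) : Prop :=
  exists W : {set 'I_n}, #|W| = k /\ is_diameter_graph d a W /\
                         chromatic_number_is a W d.+1 /\ induced_connected a W.

(* u_d(n,p): largest positive k with P(event) > 1/2, or 0 if none.
   (For k > n the event is empty, so restricting to k <= n loses nothing.) *)
Definition u_d (d n : nat) (p : R) : nat :=
  \max_(k < n.+1 | (0 < k)%N && decb (@Pnp n p (@event_u d n k) > 1/2)%R) k.
Definition u_d' (d n : nat) (p : R) : nat :=
  \max_(k < n.+1 | (0 < k)%N && decb (@Pnp n p (@event_u' d n k) > 1/2)%R) k.

Definition logb (b x : R) : R := (ln x / ln b)%R.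

(* Main.v *)
Require Import Defs.
From Stdlib Require Import ZArith Reals Lra.
From mathcomp Require Import all_boot all_order all_algebra.
From mathcomp Require Import Rstruct.
From mathcomp Require Import ring lra zify.
Set Implicit Arguments. Unset Strict Implicit. Unset Printing Implicit Defensive.
Import Order.TTheory GRing.Theory Num.Theory.

(* Look for a "star with one extra edge": a triangle ABC together with an
   independent set of s vertices, all adjacent to A and to neither B nor C.
   Placing A at the centre of a circle, B and C at the ends of a 60 degree arc
   and the s leaves inside that arc shows that this is a diameter graph in the
   plane; it is connected and needs three colours because of the triangle.

   Such a star on s + 3 vertices exists with probability > 1/2 by a second
   moment argument.  The triangle ranges over about n/6 fixed disjoint triples,
   and the a-th leaf over the a-th of s fixed disjoint blocks of M ~ n/(2s)
   vertices, so that two candidates are described by (i, f) and (j, g) and the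
   agreement set of f and g has a product distribution.  With q = 1 - p, l
   agreements cost at most q^(-l(l-1)/2) <= Y^l, where Y = q^(-bound/2) =
   (np)^(1-eps/2) p^2, and a common triangle costs a further factor
   p^(-3) (p q^2)^(-l).  The relative second moment is therefore at most
     (1 + Y/M)^s + (1 + Y/(M p q^2))^s / (t p^3),
   with t the number of triples, and s Y / (M p q^2) -> 0, t p^3 -> oo. *)

(** * The star as a diameter graph *)

Section Star.
Local Open Scope R_scope.

Definition plane_point (x y : R) : point 2 := fun i => if i == 0%N :> nat then x else y.

Lemma edist_plane (x y x' y' : R) :
  edist (plane_point x y) (plane_point x' y')
    = sqrt ((x - x') * (x - x') + (y - y') * (y - y')).
Proof.
by rewrite /edist !big_ord_recl big_ord0 /plane_point /= Rplus_0_r.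
Qed.

(* For |y| <= 1/2 this runs over the 60 degree arc of the unit circle centred
   at [plane_point 0 0]. *)
Definition arc_point (y : R) : point 2 := plane_point (sqrt (1 - y * y)) y.

Lemma edist_arc_origin y : -1/2 <= y <= 1/2 ->
  edist (plane_point 0 0) (arc_point y) = 1 /\ edist (arc_point y) (plane_point 0 0) = 1.
Proof.
move=> hy; rewrite !edist_plane.
have hx : sqrt (1 - y * y) * sqrt (1 - y * y) = 1 - y * y by apply: sqrt_sqrt; Lra.nra.
by split; rewrite -[RHS]sqrt_1; congr sqrt; Lra.nra.
Qed.

(** Both points are unit vectors, so their inner product has to exceed 1/2. The abscissas are at
    least sqrt(3)/2 each and contribute at least 3/4, which leaves room for [-1/4 < y * z]. *)
Lemma edist_arc_lt (y z : R) : -1/2 <= y <= 1/2 -> -1/2 <= z <= 1/2 ->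
  -1/4 < y * z -> edist (arc_point y) (arc_point z) < 1.
Proof.
move=> hy hz hyz; rewrite edist_plane -[X in _ < X]sqrt_1.
have hx : sqrt (1 - y * y) * sqrt (1 - y * y) = 1 - y * y by apply: sqrt_sqrt; Lra.nra.
have hw : sqrt (1 - z * z) * sqrt (1 - z * z) = 1 - z * z by apply: sqrt_sqrt; Lra.nra.
have := sqrt_pos (1 - y * y); have := sqrt_pos (1 - z * z).
move: hx hw; move: (sqrt _) (sqrt _) => x w hx hw w0 x0.
have : 3/4 <= x * w.
  apply: Rsqr_incr_0_var; last by Lra.nra.
  have -> : Rsqr (x * w) = (x * x) * (w * w) by rewrite /Rsqr; Lra.lra.
  rewrite hx hw /Rsqr.
  have y2 : y * y <= 1/4 by Lra.nra.
  have z2 : z * z <= 1/4 by Lra.nra.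
  by move: (y * y) (z * z) y2 z2 => u v u4 v4; Lra.nra.
move=> xw; apply: sqrt_lt_1; [|Lra.lra|Lra.lra].
by apply: Rplus_le_le_0_compat; apply: Rle_0_sqr.
Qed.

Lemma edist_arc_ends :
  edist (arc_point (1/2)) (arc_point (-1/2)) = 1 /\
  edist (arc_point (-1/2)) (arc_point (1/2)) = 1.
Proof.
rewrite !edist_plane.
have -> : 1 - 1/2 * (1/2) = 3/4 by Lra.lra.
have -> : 1 - -1/2 * (-1/2) = 3/4 by Lra.lra.
by split; rewrite -[RHS]sqrt_1; congr sqrt; Lra.lra.
Qed.

Variables (n : nat) (a : rel 'I_n) (A B C : 'I_n) (S : {set 'I_n}).
Hypotheses (a_sym : symmetric a) (a_irr : irreflexive a).
Hypotheses (neqAB : A != B) (neqAC : A != C) (neqBC : B != C).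
Hypotheses (AnS : A \notin S) (BnS : B \notin S) (CnS : C \notin S).
Hypotheses (aAB : a A B) (aAC : a A C) (aBC : a B C).
Hypotheses (aAS : {in S, forall x, a A x}) (aBS : {in S, forall x, ~~ a B x}).
Hypotheses (aCS : {in S, forall x, ~~ a C x}) (aSS : {in S &, forall x y, ~~ a x y}).

Let W := A |: (B |: (C |: S)).

(* The leaves get distinct heights in (0, 1/3]. *)
Definition arc_height (v : 'I_n) : R :=
  if v == B then 1/2 else if v == C then -1/2 else / (INR v + 3).

Definition star_point (v : 'I_n) : point 2 :=
  if v == A then plane_point 0 0 else arc_point (arc_height v).

Lemma inv_height (v : 'I_n) : 0 < / (INR v + 3) <= 1/3.
Proof.
have := pos_INR v => v0; split; first by apply: Rinv_0_lt_compat; Lra.lra.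
have -> : 1/3 = / 3 by Lra.lra.
by apply: Rinv_le_contravar; Lra.lra.
Qed.

Lemma arc_height_bound v : -1/2 <= arc_height v <= 1/2.
Proof.
rewrite /arc_height; have := inv_height v.
by case: ifP => _; first Lra.lra; case: ifP => _; Lra.lra.
Qed.

Lemma arc_height_inj : injective arc_height.
Proof.
move=> x y; rewrite /arc_height; have := inv_height x; have := inv_height y.
case: (eqVneq x B) => [->|_]; case: (eqVneq y B) => [->|_] //.
- by case: ifP => _; Lra.lra.
- by case: ifP => _; Lra.lra.
case: (eqVneq x C) => [->|_]; case: (eqVneq y C) => [->|_] //; try Lra.lra.
move=> hx hy /Rinv_eq_reg h; apply: val_inj; apply: INR_eq; exact: Rplus_eq_reg_r h.
Qed.

(** A negative product involves C, at height -1/2. Its partner is not B, because BC is an edge, so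
    it has height at most 1/3 and the product is at least -1/6. *)
Lemma arc_height_mul x y : (x == y) || ~~ a x y -> x != A -> y != A ->
  -1/4 < arc_height x * arc_height y.
Proof.
rewrite /arc_height; have := inv_height x; have := inv_height y.
move: (/ (INR x + 3)) (/ (INR y + 3)) => u v.
have aCB : a C B by rewrite a_sym.
case: (eqVneq x B) => [xB|_]; case: (eqVneq y B) => [yB|_];
case: (eqVneq x C) => [xC|_]; case: (eqVneq y C) => [yC|_];
  rewrite ?xB ?yB ?xC ?yC ?aBC ?aCB ?(negbTE neqBC) ?[C == B]eq_sym ?(negbTE neqBC) //=;
  by Lra.nra.
Qed.

Lemma star_diameter_graph : is_diameter_graph 2 a W.
Proof.
exists star_point; split.
  move=> x y _ _; rewrite /star_point.
  have pos v : 0 < sqrt (1 - arc_height v * arc_height v).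
    by apply: sqrt_lt_R0; have := arc_height_bound v; Lra.nra.
  case: (eqVneq x A) => [->|_]; case: (eqVneq y A) => [->|_] // h.
  - have e : 0 = sqrt (1 - arc_height y * arc_height y) := congr1 (fun f => f ord0) h.
    by have := pos y; Lra.lra.
  - have e : sqrt (1 - arc_height x * arc_height x) = 0 := congr1 (fun f => f ord0) h.
    by have := pos x; Lra.lra.
  by apply: arc_height_inj; have := congr1 (fun f => f ord_max) h.
have main x y : x \in W -> y \in W -> edist (star_point x) (star_point y) <= 1 /\
    (x <> y -> (a x y = true <-> edist (star_point x) (star_point y) = 1)).
  move=> xW yW; rewrite /star_point.
  have inA z : z \in W -> z != A -> a A z.
    by rewrite !inE => /or4P[/eqP->|/eqP->|/eqP->|/aAS ->] //; rewrite eqxx.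
  case: (eqVneq x A) => [->|xA]; case: (eqVneq y A) => [->|yA].
  - split=> //; rewrite edist_plane.
    by rewrite (_ : _ + _ = 0) ?sqrt_0; [Lra.lra|Lra.lra].
  - have [-> _] := edist_arc_origin (arc_height_bound y).
    by split; [Lra.lra|rewrite inA].
  - have [_ ->] := edist_arc_origin (arc_height_bound x).
    by split; [Lra.lra|rewrite a_sym inA].
  case axy: (a x y); last first.
    have lt1 : edist (arc_point (arc_height x)) (arc_point (arc_height y)) < 1.
      apply: edist_arc_lt; try exact: arc_height_bound.
      by apply: arc_height_mul; rewrite ?axy ?orbT.
    by split; [Lra.lra|move=> _; split=> // h; Lra.lra].
  suff -> : edist (arc_point (arc_height x)) (arc_point (arc_height y)) = 1.
    by split; [Lra.lra|].
  (* BC is the only edge of the star that avoids A. *)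
  have ends : (x == B) && (y == C) || (x == C) && (y == B).
    move: xW yW axy; rewrite !inE (negbTE xA) (negbTE yA) /=.
    case/or3P=> [/eqP->|/eqP->|xS]; case/or3P=> [/eqP->|/eqP->|yS];
      rewrite ?eqxx ?orbT ?a_irr // ?[a _ B]a_sym ?[a _ C]a_sym
        ?(negbTE (aBS xS)) ?(negbTE (aBS yS)) ?(negbTE (aCS xS)) ?(negbTE (aCS yS))
        ?(negbTE (aSS xS yS)) //.
  have [e1 e2] := edist_arc_ends.
  case/orP: ends => /andP[/eqP-> /eqP->]; rewrite /arc_height eqxx;
    by rewrite [C == B]eq_sym (negbTE neqBC) eqxx.
exists 1; split; first by move=> x y xW yW; case: (main x y xW yW).
have AW : A \in W by rewrite !inE eqxx.
have BW : B \in W by rewrite !inE eqxx orbT.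
split; last by move=> x y xW yW xy; apply: (main x y xW yW).2.
exists A, B; split=> //; split=> //; apply/(main A B AW BW).2 => //.
exact/eqP.
Qed.

(** C and the leaves form an independent set and share a colour; the triangle forces three
    colours. *)
Lemma star_chromatic_number : chromatic_number_is a W 3.
Proof.
split=> [|k [c [ck cP]]].
  exists (fun x => if x == A then 0%N else if x == B then 1%N else 2%N).
  split=> [x _|x y xW yW axy]; first by case: ifP => // _; case: ifP.
  case: (eqVneq x A) axy => [->|xA]; case: (eqVneq y A) => [->|yA]; rewrite ?a_irr //.
  - by case: ifP.
  - by case: ifP.
  case: (eqVneq x B) => [->|xB]; case: (eqVneq y B) => [->|yB]; rewrite ?a_irr //.
  move: xW yW; rewrite !inE (negbTE xA) (negbTE yA) (negbTE xB) (negbTE yB) /=.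
  case/orP=> [/eqP->|xS]; case/orP=> [/eqP->|yS]; rewrite ?a_irr //.
  - by rewrite (negbTE (aCS yS)).
  - by rewrite a_sym (negbTE (aCS xS)).
  by rewrite (negbTE (aSS xS yS)).
have AW : A \in W by rewrite !inE eqxx.
have BW : B \in W by rewrite !inE eqxx orbT.
have CW : C \in W by rewrite !inE eqxx !orbT.
have := ck _ AW; have := ck _ BW; have := ck _ CW.
have := cP _ _ AW BW aAB; have := cP _ _ AW CW aAC; have := cP _ _ BW CW aBC.
move: (c A) (c B) (c C) => x y z; case: k {ck} => [|[|[|k]]] //.
  by case: x => [|x] //; case: y => [|y] //; case: z.
by case: x => [|[|x]] //; case: y => [|[|y]] //; case: z => [|[|z]].
Qed.

Lemma star_connected : induced_connected a W.
Proof.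
have AW : A \in W by rewrite !inE eqxx.
have fromA z : z \in W -> connect (fun u v => [&& a u v, u \in W & v \in W]) A z.
  move=> zW; case: (eqVneq z A) => [->|zA]; first exact: connect0.
  apply: connect1; rewrite AW zW !andbT.
  by move: zW; rewrite !inE (negbTE zA) /= => /or3P[/eqP->|/eqP->|/aAS].
have csym : connect_sym (fun u v => [&& a u v, u \in W & v \in W]).
  by apply: sym_connect_sym => u v; rewrite a_sym [(u \in W) && _]andbC.
move=> x y xW yW; apply: connect_trans (fromA y yW).
by rewrite csym; apply: fromA.
Qed.

Lemma star_event : event_u' 2 #|S|.+3 a.
Proof.
exists W; split; last first.
  split; first exact: star_diameter_graph.
  by split; [exact: star_chromatic_number|exact: star_connected].
by rewrite !cardsU1 !inE (negbTE neqAB) (negbTE neqAC) (negbTE neqBC) AnS BnS CnS.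
Qed.
End Star.

Local Open Scope ring_scope.

(** * Second moment for families of edge patterns *)

Section SecondMoment.
Variables (F : realFieldType) (n : nat) (p : F).
Local Notation edge := ('I_n * 'I_n)%type.
Local Notation graph := {ffun edge -> bool}.

(** The factors of [gnp_weight], over an arbitrary real field. *)
Definition edge_weight (e : edge) (b : bool) : F :=
  if (e.1 < e.2)%N then (if b then p else 1 - p) else (if b then 0 else 1).

Definition graph_weight (g : graph) : F := \prod_e edge_weight e (g e).

Definition meets (P N : {set edge}) (e : edge) (b : bool) : bool :=
  ((e \in P) ==> b) && ((e \in N) ==> ~~ b).

Definition matches (P N : {set edge}) (g : graph) : bool :=
  [forall e, meets P N e (g e)].

Lemma graph_weight_ge0 g : 0 < p -> p < 1 -> 0 <= graph_weight g.
Proof.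
move=> p_gt0 p_lt1.
apply: prodr_ge0 => e _; rewrite /edge_weight.
by case: ifP => _; case: (g e) => //=; lra.
Qed.

(** Independence of the edges: a condition imposed edge by edge has a probability that factorizes,
    by expanding the product of sums. *)
Lemma expect_local (c : edge -> bool -> bool) :
  \sum_g graph_weight g * [forall e, c e (g e)]%:R
    = \prod_e \sum_b edge_weight e b * (c e b)%:R.
Proof.
rewrite bigA_distr_bigA /=; apply: eq_bigr => g _.
rewrite big_split /=; congr (_ * _).
case: forallP => [cg|/forallP]; first by rewrite big1 // => e _; rewrite cg.
rewrite negb_forall => /existsP[e /negbTE ce].
by rewrite (bigD1 e) //= ce mul0r.
Qed.

Definition pattern_prob (P N : {set edge}) : F :=
  \sum_g graph_weight g * (matches P N g)%:R.

Definition canonical (P : {set edge}) : Prop := forall e, e \in P -> (e.1 < e.2)%N.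

(** Every factor is p, 1 - p or 1. A required pair that is not increasing would have weight 0, hence
    [canonical P]. *)
Lemma pattern_prob_gt0 (P N : {set edge}) :
  0 < p -> p < 1 -> canonical P -> [disjoint P & N] -> 0 < pattern_prob P N.
Proof.
move=> p_gt0 p_lt1 cP dPN; rewrite /pattern_prob expect_local; apply: prodr_gt0 => e _.
rewrite big_bool /edge_weight /meets /=.
have := cP e; have := disjointFr dPN (x := e).
case: (e \in P) => [/(_ isT) -> /(_ isT) ->|_ _] /=; first by rewrite mulr1 mulr0 addr0.
by case: (e \in N); case: ifP; rewrite ?mulr1 ?mulr0 ?add0r; lra.
Qed.

(** Compared edge by edge: an edge required twice is paid for once and gains 1/p, one forbidden
    twice gains 1/(1 - p). An edge required by one pattern and forbidden by the other makes the left
    side 0, whence an inequality. *)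
Lemma pattern_prob_joint (P N P' N' : {set edge}) :
    0 < p -> p < 1 -> canonical P -> canonical P' -> canonical N -> canonical N' ->
    [disjoint P & N] -> [disjoint P' & N'] ->
  \sum_g graph_weight g * ((matches P N g)%:R * (matches P' N' g)%:R)
    <= pattern_prob P N * pattern_prob P' N'
         * (p ^- #|P :&: P'| * (1 - p) ^- #|N :&: N'|).
Proof.
move=> p_gt0 p_lt1 cP cP' cN cN' dPN dPN'.
have -> : \sum_g graph_weight g * ((matches P N g)%:R * (matches P' N' g)%:R)
    = \sum_g graph_weight g
        * [forall e, meets P N e (g e) && meets P' N' e (g e)]%:R.
  apply: eq_bigr => g _; congr (_ * _); rewrite -natrM mulnb; congr (_%:R).
  congr nat_of_bool; apply/andP/forallP => [[/forallP m1 /forallP m2] e|m].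
    by rewrite m1 m2.
  by split; apply/forallP => e; case/andP: (m e).
rewrite (expect_local (fun e b => meets P N e b && meets P' N' e b)).
rewrite /pattern_prob !expect_local -!exprVn -!prodr_const.
rewrite (big_mkcond (mem (P :&: P'))) (big_mkcond (mem (N :&: N'))) /=.
rewrite -!big_split /=; apply: ler_prod => e _; apply/andP; split.
  apply: sumr_ge0 => b _; apply: mulr_ge0 => //.
  by rewrite /edge_weight; case: ifP; case: b => //=; lra.
rewrite !big_bool /edge_weight /meets !inE /=.
have /implyP := cP e; have /implyP := cP' e.
have /implyP := cN e; have /implyP := cN' e.
have : (e \in P) ==> (e \notin N) by apply/implyP => /(disjointFr dPN) ->.
have : (e \in P') ==> (e \notin N') by apply/implyP => /(disjointFr dPN') ->.
have p0 : p != 0 by lra.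
have q0 : 1 - p != 0 by lra.
have pp : p * p^-1 = 1 by field.
have qq : (1 - p) * (1 - p)^-1 = 1 by field.
case: (e \in P); case: (e \in P'); case: (e \in N); case: (e \in N');
  rewrite //= ?mulr0 ?mulr1 ?addr0 ?add0r; case: ifP => //= _ _ _ _ _ _ _;
  by nra.
Qed.

(* Weighting each pattern by its inverse probability makes every term of the
   first moment equal to 1; then 1[X > 0] >= 2 X / E X - (X / E X)^2 replaces
   Cauchy-Schwarz. *)
Lemma second_moment (I : finType) (P N : I -> {set edge}) (E : pred graph) :
    0 < p -> p < 1 -> (0 < #|I|)%N ->
    (forall i, canonical (P i)) -> (forall i, canonical (N i)) ->
    (forall i, [disjoint P i & N i]) ->
    (forall i g, matches (P i) (N i) g -> E g) ->
    \sum_i \sum_j p ^- #|P i :&: P j| * (1 - p) ^- #|N i :&: N j|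
      < 3 / 2 * #|I|%:R ^+ 2 ->
  1 / 2 < \sum_g graph_weight g * (E g)%:R.
Proof.
move=> p_gt0 p_lt1 I_gt0 cP cN dPN mE small.
pose K : F := #|I|%:R; have K_gt0 : 0 < K by rewrite ltr0n.
pose m i g : F := (matches (P i) (N i) g)%:R.
pose w i := (pattern_prob (P i) (N i))^-1.
have w_gt0 i : 0 < w i by rewrite invr_gt0 pattern_prob_gt0.
pose X g := \sum_i w i * m i g.
have EX : \sum_g graph_weight g * X g = K.
  under eq_bigr do rewrite mulr_sumr.
  rewrite exchange_big /= /K -sum1_card natr_sum; apply: eq_bigr => i _.
  under eq_bigr do rewrite mulrCA.
  by rewrite -mulr_sumr mulVf // gt_eqF // pattern_prob_gt0.
have EX2 : \sum_g graph_weight g * X g ^+ 2 < 3 / 2 * K ^+ 2.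
  apply: le_lt_trans small.
  under eq_bigr do rewrite expr2 mulr_suml mulr_sumr.
  rewrite exchange_big /=; apply: ler_sum => i _.
  under eq_bigr do rewrite mulr_sumr mulr_sumr.
  rewrite exchange_big /=; apply: ler_sum => j _.
  have -> : \sum_g graph_weight g * (w i * m i g * (w j * m j g))
      = w i * w j * \sum_g graph_weight g * (m i g * m j g).
    by rewrite mulr_sumr; apply: eq_bigr => g _; ring.
  have le_ij := pattern_prob_joint p_gt0 p_lt1 (cP i) (cP j) (cN i) (cN j) (dPN i) (dPN j).
  apply: le_trans (ler_wpM2l (ltW (mulr_gt0 (w_gt0 i) (w_gt0 j))) le_ij) _.
  by rewrite mulrA [X in X * _]mulrACA /w !mulVf ?mul1r // gt_eqF // pattern_prob_gt0.
(* Since E X = K, the left side is 2 - E X^2 / K^2 > 2 - 3/2, which is where the threshold 3/2 comes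
   from. *)
have : \sum_g graph_weight g * (2 / K * X g - X g ^+ 2 / K ^+ 2)
       <= \sum_g graph_weight g * (E g)%:R.
  apply: ler_sum => g _; apply: ler_wpM2l; first exact: graph_weight_ge0.
  have [Eg|Eg] := boolP (E g).
    rewrite mulr1n; have := sqr_ge0 (1 - X g / K); rewrite -subr_ge0; congr (0 <= _).
    by field; rewrite gt_eqF.
  rewrite /X big1 ?mulr0 ?expr0n /= ?mul0r ?subr0 // => i _.
  by rewrite /m; case: matches (mE i g) Eg => [->|_ _]; rewrite ?mulr0.
apply: lt_le_trans.
have -> : \sum_g graph_weight g * (2 / K * X g - X g ^+ 2 / K ^+ 2)
    = 2 / K * (\sum_g graph_weight g * X g)
      - (\sum_g graph_weight g * X g ^+ 2) / K ^+ 2.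
  rewrite mulr_sumr mulr_suml -sumrB; apply: eq_bigr => g _; ring.
rewrite EX divfK ?gt_eqF //.
have : (\sum_g graph_weight g * X g ^+ 2) / K ^+ 2 < 3 / 2.
  by rewrite ltr_pdivrMr // exprn_gt0.
lra.
Qed.
End SecondMoment.

(** * The planted stars and their overlaps *)

Section Agreement.
Variables (F : comNzRingType) (s M : nat).

Definition agreement (f g : {ffun 'I_s -> 'I_M}) : {set 'I_s} :=
  [set a | f a == g a].

(** For fixed f the sum over g factorizes over the coordinates: one value of g a agrees and gives c,
    the other M - 1 give 1. *)
Lemma sum_agreement (c : F) :
  \sum_f \sum_g c ^+ #|agreement f g| = (M%:R * (c + M%:R - 1)) ^+ s.
Proof.
have inner (f : {ffun 'I_s -> 'I_M}) :
    \sum_g c ^+ #|agreement f g| = (c + M%:R - 1) ^+ s.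
  transitivity (\sum_(g : {ffun 'I_s -> 'I_M}) \prod_a (if f a == g a then c else 1)).
    apply: eq_bigr => g _; rewrite -prodr_const big_mkcond /=.
    by apply: eq_bigr => a _; rewrite inE.
  rewrite -(bigA_distr_bigA (fun a b => if f a == b then c else 1)) /=.
  transitivity (\prod_(a < s) (c + M%:R - 1)); last by rewrite prodr_const card_ord.
  apply: eq_bigr => a _; rewrite (bigD1 (f a)) //= eqxx -addrA; congr (_ + _).
  under eq_bigr => b ba do rewrite eq_sym (negbTE ba).
  rewrite sumr_const cardC1 card_ord; case: (M) (f a) => [[]//|k _].
  by rewrite mulrSr addrK.
under eq_bigr do rewrite inner.
by rewrite sumr_const card_ffun !card_ord exprMn -[LHS]mulr_natl natrX.
Qed.
End Agreement.

(** The increasing pairs, their reversals and the diagonal are disjoint subsets of A x A. *)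
Lemma card_increasing_pairs s (A : {set 'I_s}) :
  (2 * #|[set ab : 'I_s * 'I_s | [&& ab.1 < ab.2, ab.1 \in A & ab.2 \in A]]|
     <= #|A| * #|A|.-1)%N.
Proof.
set D := [set ab | _].
pose D' := [set ab : 'I_s * 'I_s | (ab.2, ab.1) \in D].
pose Dg := [set (a, a) | a in A].
have cD' : #|D'| = #|D|.
  rewrite -(card_imset (mem D) (f := fun ab : 'I_s * 'I_s => (ab.2, ab.1))); last first.
    by move=> [x y] [z w] [-> ->].
  apply: eq_card => -[x y]; rewrite !inE; apply/idP/imsetP => [h|[[z w] + [-> ->]]].
    by exists (y, x) => //; rewrite inE.
  by rewrite inE.
have cDg : #|Dg| = #|A| by rewrite card_imset // => x y [].
have dis1 : [disjoint D & D'].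
  rewrite -setI_eq0; apply/eqP/setP => -[x y]; rewrite !inE /=.
  by apply/negP => /andP[/and3P[h _ _] /and3P[h' _ _]]; lia.
have dis2 : [disjoint D :|: D' & Dg].
  rewrite -setI_eq0; apply/eqP/setP => -[x y]; rewrite !inE /=.
  apply/negP => /andP[h /imsetP[z _ [xz yz]]]; move: h; rewrite xz yz; lia.
have sub : (D :|: D') :|: Dg \subset setX A A.
  apply/subsetP => -[x y]; rewrite !inE /= => /orP[/orP[/and3P[_ -> ->]|/and3P[_ -> ->]]|] //.
  by move=> /imsetP[z zA [-> ->]]; rewrite zA.
have := subset_leq_card sub; rewrite cardsX.
have -> : #|D :|: D' :|: Dg| = (#|D| + #|D| + #|A|)%N.
  move: dis1 dis2; rewrite -!leq_card_setU => /eqP e1 /eqP e2.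
  by rewrite e2 e1 cD' cDg.
by move: #|D| #|A| => d [|m] /= ; nia.
Qed.

Section Construction.
Variables (n t s M : nat).
Hypothesis fits : (3 * t + s * M <= n.+1)%N.
Local Notation index := ('I_t * {ffun 'I_s -> 'I_M})%type.
Local Notation edge := ('I_n.+1 * 'I_n.+1)%type.

(* Triangle [i] sits on the vertices 3i, 3i+1, 3i+2; the s blocks of M possible
   leaves come after all the triangles.  Hence every pair below is increasing,
   as the encoding of graphs requires. *)
Definition corner (k : nat) (i : 'I_t) : 'I_n.+1 := inord (3 * i + k).
Definition leaf (a : 'I_s) (b : 'I_M) : 'I_n.+1 := inord (3 * t + (a * M + b)).

Lemma corner_val k i : (k < 3)%N -> corner k i = (3 * i + k)%N :> nat.
Proof. by move=> k3; rewrite /corner inordK //; have := ltn_ord i; lia. Qed.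

Lemma leaf_val a b : leaf a b = (3 * t + (a * M + b))%N :> nat.
Proof.
rewrite /leaf inordK //; have := ltn_ord b; have := ltn_ord a; nia.
Qed.

Lemma corner_inj k k' i i' : (k < 3)%N -> (k' < 3)%N ->
  corner k i = corner k' i' -> k = k' /\ i = i'.
Proof.
move=> k3 k3' /(congr1 val) /=; rewrite !corner_val // => h.
have [-> e] : k = k' /\ i = i' :> nat by lia.
by split=> //; apply: val_inj.
Qed.

Lemma leaf_inj a b a' b' : leaf a b = leaf a' b' -> a = a' /\ b = b'.
Proof.
move=> /(congr1 val) /=; rewrite !leaf_val => /addnI h.
have M0 : (0 < M)%N by apply: leq_ltn_trans (ltn_ord b).
split; apply: val_inj => /=.
  by have := congr1 (divn^~ M) h; rewrite !divnMDl // !divn_small // !addn0.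
by have := congr1 (modn^~ M) h; rewrite !modnMDl !modn_small.
Qed.

Lemma corner_lt_leaf k i a b : (k < 3)%N -> (corner k i < leaf a b)%N.
Proof. by move=> k3; rewrite corner_val // leaf_val; have := ltn_ord i; lia. Qed.

(** A corner with k < 3 is never a leaf; stated as an equation, this turns into [true = false] as
    soon as k is a numeral. *)
Lemma corner_eq_leaf k i a b : corner k i = leaf a b -> (k < 3)%N = false.
Proof.
by move=> e; apply/negbTE/negP => k3; have := corner_lt_leaf i a b k3; rewrite e ltnn.
Qed.

Lemma leaf_lt (a a' : 'I_s) (b b' : 'I_M) : (a < a')%N -> (leaf a b < leaf a' b')%N.
Proof.
by rewrite !leaf_val => lt_aa'; have := ltn_ord b; have := ltn_ord a'; nia.
Qed.

Definition chosen (x : index) (a : 'I_s) : 'I_n.+1 := leaf a (x.2 a).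

Definition triangle (i : 'I_t) : {set edge} :=
  [set (corner 0 i, corner 1 i); (corner 0 i, corner 2 i); (corner 1 i, corner 2 i)].

(** Corner 0 plays the centre A, corners 1 and 2 the arc ends B and C. *)
Definition present (x : index) : {set edge} :=
  triangle x.1 :|: [set (corner 0 x.1, chosen x a) | a : 'I_s].

Definition absent (x : index) : {set edge} :=
  [set (corner 1 x.1, chosen x a) | a : 'I_s]
    :|: [set (corner 2 x.1, chosen x a) | a : 'I_s]
    :|: [set (chosen x ab.1, chosen x ab.2) | ab : 'I_s * 'I_s & (ab.1 < ab.2)%N].

Lemma presentP x e : e \in present x ->
  [\/ e \in triangle x.1 | exists a, e = (corner 0 x.1, chosen x a)].
Proof.
by rewrite inE => /orP[|/imsetP[a _ ->]]; [left|right; exists a].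
Qed.

Lemma absentP x e : e \in absent x ->
  [\/ exists a, e = (corner 1 x.1, chosen x a),
      exists a, e = (corner 2 x.1, chosen x a) |
      exists a b : 'I_s, (a < b)%N /\ e = (chosen x a, chosen x b)].
Proof.
rewrite !inE => /orP[/orP[/imsetP[a _ ->]|/imsetP[a _ ->]]|/imsetP[[a b] ab ->]].
- by apply: Or31; exists a.
- by apply: Or32; exists a.
by apply: Or33; exists a, b; rewrite inE in ab.
Qed.

Lemma triangleP i e : e \in triangle i ->
  exists k k', [/\ (k < k')%N, (k' < 3)%N & e = (corner k i, corner k' i)].
Proof.
rewrite !inE => /orP[/orP[]|] /eqP->; first by exists 0%N, 1%N.
  by exists 0%N, 2%N.
by exists 1%N, 2%N.
Qed.

Lemma present_canonical x : canonical (present x).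
Proof.
move=> e /presentP[/triangleP[k [k' [kk' k3 ->]]]|[a ->]] /=.
  by rewrite !corner_val //; lia.
exact: corner_lt_leaf.
Qed.

Lemma absent_canonical x : canonical (absent x).
Proof.
move=> e /absentP[[a ->]|[a ->]|[a [b [ab ->]]]] /=; try exact: corner_lt_leaf.
exact: leaf_lt.
Qed.

Lemma present_absent_disjoint x : [disjoint present x & absent x].
Proof.
rewrite -setI_eq0; apply/eqP/setP => e; rewrite in_setI in_set0; apply/negP => /andP[].
case/presentP=> [/triangleP[k [k' [kk' k3 ->]]]|[a ->]];
  case/absentP=> [[b]|[b]|[b [c [bc]]]] [].
- by move=> _ /corner_eq_leaf; rewrite k3.
- by move=> _ /corner_eq_leaf; rewrite k3.
- by move=> _ /corner_eq_leaf; rewrite k3.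
- by case/corner_inj.
- by case/corner_inj.
by move/corner_eq_leaf.
Qed.

(** Each present pair starts at a corner, which determines the triangle. With a common triangle, the
    shared pairs are its three edges and one edge from A per agreement. *)
Lemma present_overlap x y :
  (#|present x :&: present y|
     <= if x.1 == y.1 then 3 + #|agreement x.2 y.2| else 0)%N.
Proof.
case: eqP => [exy|nxy].
  apply: (@leq_trans #|triangle x.1
      :|: [set (corner 0 x.1, chosen x a) | a in agreement x.2 y.2]|).
    apply: subset_leq_card; apply/subsetP => e; rewrite in_setI => /andP[].
    case/presentP=> [tx _|[a ->]]; first by rewrite inE tx.
    case/presentP=> [/triangleP[k [k' [kk' k3 [_ /esym/corner_eq_leaf]]]]|].
      by rewrite k3.
    case=> b [_ /leaf_inj[ab fg]]; rewrite inE; apply/orP; right.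
    by apply: imset_f; rewrite inE fg ab.
  apply: leq_trans (leq_card_setU _ _) _; apply: leq_add.
    rewrite /triangle; apply: leq_trans (leq_card_setU _ _) _.
    by rewrite cards1 cards2; case: (_ != _).
  exact: leq_imset_card.
rewrite leqn0 cards_eq0; apply/eqP/setP => e; rewrite in_setI in_set0.
apply/negP => /andP[].
case/presentP=> [/triangleP[k [k' [kk' k3 ->]]]|[a ->]];
  case/presentP=> [/triangleP[l [l' [ll' l3]]]|[b]] [];
  by case/corner_inj => //; lia.
Qed.

(** Pairs of leaves are shared wherever both indices agree, whatever the triangles; they are counted
    by d. A common triangle adds two pairs per agreement, at B and at C. *)
Lemma absent_overlap x y :
  exists d, (2 * d <= #|agreement x.2 y.2| * #|agreement x.2 y.2|.-1)%N /\
  (#|absent x :&: absent y|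
     <= (if x.1 == y.1 then 2 * #|agreement x.2 y.2| else 0) + d)%N.
Proof.
set G := agreement _ _.
exists #|[set ab : 'I_s * 'I_s | [&& ab.1 < ab.2, ab.1 \in G & ab.2 \in G]]|%N.
split; first exact: card_increasing_pairs.
set D := [set ab | _].
pose side k := [set (corner k x.1, chosen x a) | a in G].
apply: (@leq_trans #|(if x.1 == y.1 then side 1%N :|: side 2%N else set0)
    :|: [set (chosen x ab.1, chosen x ab.2) | ab in D]|).
  apply: subset_leq_card; apply/subsetP => e; rewrite in_setI => /andP[].
  case/absentP=> [[a ->]|[a ->]|[a [b [ab ->]]]];
    case/absentP=> [[a']|[a']|[a' [b' [ab']]]] [].
  - case/corner_inj=> // _ exy /leaf_inj[aa' fg]; rewrite (introT eqP exy) 2!in_setU.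
    apply/orP; left; apply/orP; left.
    by apply: imset_f; rewrite inE fg aa'.
  - by case/corner_inj.
  - by move/corner_eq_leaf.
  - by case/corner_inj.
  - case/corner_inj=> // _ exy /leaf_inj[aa' fg]; rewrite (introT eqP exy) 2!in_setU.
    apply/orP; left; apply/orP; right.
    by apply: imset_f; rewrite inE fg aa'.
  - by move/corner_eq_leaf.
  - by move/esym/corner_eq_leaf.
  - by move/esym/corner_eq_leaf.
  move=> /leaf_inj[aa' fa] /leaf_inj[bb' fb]; rewrite inE; apply/orP; right.
  apply/imsetP; exists (a, b) => //; rewrite !inE /= ab fa fb aa' bb' !eqxx //.
apply: leq_trans (leq_card_setU _ _) _; apply: leq_add; last exact: leq_imset_card.
case: ifP => _; last by rewrite cards0.
apply: leq_trans (leq_card_setU _ _) _; rewrite mul2n -addnn.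
by apply: leq_add; apply: leq_imset_card.
Qed.
End Construction.

(** * Summation over pairs of candidate stars *)

Lemma sum_pairs_all (V : nmodType) (I J : finType) (G : J -> J -> V) :
  \sum_(x : I * J) \sum_(y : I * J) G x.2 y.2 = (\sum_f \sum_g G f g) *+ (#|I| ^ 2).
Proof.
have inner f : \sum_(y : I * J) G f y.2 = (\sum_g G f g) *+ #|I|.
  by rewrite -(pair_bigA _ (fun _ g => G f g)) /= sumr_const.
under eq_bigr do rewrite inner.
rewrite -(pair_bigA _ (fun _ f => (\sum_g G f g) *+ #|I|)) /= sumr_const.
by rewrite sumrMnl -mulrnA mulnn.
Qed.

Lemma sum_pairs_diag (V : nmodType) (I J : finType) (G : J -> J -> V) :
  \sum_(x : I * J) \sum_(y : I * J) (if x.1 == y.1 then G x.2 y.2 else 0)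
    = (\sum_f \sum_g G f g) *+ #|I|.
Proof.
have inner (x : I * J) :
    \sum_(y : I * J) (if x.1 == y.1 then G x.2 y.2 else 0) = \sum_g G x.2 g.
  rewrite -(pair_bigA _ (fun j g => if x.1 == j then G x.2 g else 0)) /=.
  rewrite (bigD1 x.1) //= eqxx [X in _ + X]big1 ?addr0 // => j.
  by rewrite eq_sym => /negbTE ->; rewrite big1.
under eq_bigr do rewrite inner.
by rewrite -(pair_bigA _ (fun _ f => \sum_g G f g)) /= sumr_const.
Qed.

(** With l agreements, a pair of candidates costs at most Y^l if the triangles differ. A common
    triangle costs a further p^(-3), and p^(-1) q^(-2) per agreement for the three pairs joining
    that leaf to the triangle. Adding the two bounds covers both cases. *)
Lemma overlap_sum (F : realFieldType) (n t s M : nat) (p Y : F) :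
    (3 * t + s * M <= n.+1)%N -> 0 < p -> p < 1 ->
    (forall l d, (l <= s)%N -> (2 * d <= l * l.-1)%N -> (1 - p) ^- d <= Y ^+ l) ->
  \sum_(x : 'I_t * {ffun 'I_s -> 'I_M}) \sum_(y : 'I_t * {ffun 'I_s -> 'I_M})
      p ^- #|present n x :&: present n y| * (1 - p) ^- #|absent n x :&: absent n y|
    <= (M%:R * (Y + M%:R - 1)) ^+ s *+ t ^ 2
       + (p ^- 3 * (M%:R * (Y / (p * (1 - p) ^+ 2) + M%:R - 1)) ^+ s) *+ t.
Proof.
move=> fits p_gt0 p_lt1 hY.
have q_gt0 : 0 < 1 - p by lra.
have q_le1 : 1 - p <= 1 by lra.
have mono (x : F) k l : 0 < x -> x <= 1 -> (k <= l)%N -> x ^- k <= x ^- l.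
  by move=> x0 x1 kl; rewrite -!exprVn ler_weXn2l // invf_ge1.
pose K := Y / (p * (1 - p) ^+ 2).
pose G1 (f g : {ffun 'I_s -> 'I_M}) := Y ^+ #|agreement f g|.
pose G2 (f g : {ffun 'I_s -> 'I_M}) := p ^- 3 * K ^+ #|agreement f g|.
have := sum_pairs_all 'I_t G1; have := sum_pairs_diag 'I_t G2.
rewrite !card_ord /G1 sum_agreement => e2 e1.
rewrite -e1 -sum_agreement mulr_sumr.
under [X in _ <= _ + X *+ _]eq_bigr do rewrite mulr_sumr.
rewrite -e2 -big_split /=; apply: ler_sum => x _.
rewrite -big_split /=; apply: ler_sum => y _.
have := present_overlap fits x y; have [d [hd]] := absent_overlap fits x y.
have ls : (#|agreement x.2 y.2| <= s)%N by rewrite -[leqRHS]card_ord max_card.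
have := hY _ _ ls hd; rewrite /G1 /G2 /K.
move: #|agreement x.2 y.2| => l dY.
have Yl : 0 <= Y ^+ l by apply: le_trans dY; rewrite -exprVn exprn_ge0 // invr_ge0 ltW.
case: eqP => _ hN hP.
  apply: (@le_trans _ _ (p ^- (3 + l) * ((1 - p) ^- (2 * l) * Y ^+ l))).
    apply: ler_pM; try by rewrite -exprVn exprn_ge0 // invr_ge0 ltW.
      by apply: mono => //; lra.
    apply: le_trans (mono _ _ _ q_gt0 q_le1 hN) _.
    rewrite exprD invfM ler_wpM2l // -exprVn exprn_ge0 // invr_ge0 ltW //.
  rewrite expr_div_n exprMn -exprM exprD ler_wpDl //.
  by rewrite !invfM; nra.
move: hP; rewrite leqn0 => /eqP ->; rewrite expr0 invr1 mul1r addr0.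
exact: le_trans (mono _ _ _ q_gt0 q_le1 hN) dY.
Qed.

(** * From matched patterns to the event in G(n,p) *)

Lemma adj_lt n (g : {ffun 'I_n * 'I_n -> bool}) (i j : 'I_n) :
  (i < j)%N -> adj g i j = g (i, j).
Proof. by move=> ij; rewrite /adj ij ltnNge (ltnW ij) orbF. Qed.

Lemma adj_sym n (g : {ffun 'I_n * 'I_n -> bool}) : symmetric (adj g).
Proof. by move=> i j; rewrite /adj orbC. Qed.

Lemma adj_irr n (g : {ffun 'I_n * 'I_n -> bool}) : irreflexive (adj g).
Proof. by move=> i; rewrite /adj ltnn. Qed.

Lemma star_of_pattern (n t s M : nat) (x : 'I_t * {ffun 'I_s -> 'I_M})
    (g : {ffun 'I_n.+1 * 'I_n.+1 -> bool}) :
    (3 * t + s * M <= n.+1)%N -> matches (present n x) (absent n x) g ->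
  event_u' 2 s.+3 (adj g).
Proof.
move=> fits /forallP ok.
have yes e : e \in present n x -> g e by move=> eP; have := ok e; rewrite /meets eP => /andP[].
have no e : e \in absent n x -> ~~ g e.
  by move=> eN; have := ok e; rewrite /meets eN => /andP[].
pose S := [set chosen n x a | a : 'I_s].
have cS : #|S| = s.
  by rewrite card_imset ?card_ord // => a b /(leaf_inj fits)[].
have corner_lt k k' : (k < k')%N -> (k' < 3)%N ->
    (corner n k x.1 < corner n k' x.1)%N.
  by move=> kk' k3; rewrite !(corner_val fits) //; lia.
have nS k : (k < 3)%N -> corner n k x.1 \notin S.
  by move=> k3; apply/imsetP => -[a _ /(corner_eq_leaf fits)]; rewrite k3.
have ne k k' : (k < k')%N -> (k' < 3)%N -> corner n k x.1 != corner n k' x.1.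
  by move=> kk' k3; apply/eqP => e; have := corner_lt _ _ kk' k3; rewrite e ltnn.
rewrite -[s in s.+3]cS.
apply: (@star_event _ _ (corner n 0 x.1) (corner n 1 x.1) (corner n 2 x.1));
  rewrite ?ne ?nS //; try exact: adj_sym; try exact: adj_irr.
- by rewrite adj_lt ?corner_lt // yes // !inE eqxx.
- by rewrite adj_lt ?corner_lt // yes // !inE eqxx orbT.
- by rewrite adj_lt ?corner_lt // yes // !inE eqxx !orbT.
- move=> _ /imsetP[a _ ->]; rewrite adj_lt ?(corner_lt_leaf fits) // yes //.
  by rewrite in_setU imset_f ?orbT.
- move=> _ /imsetP[a _ ->]; rewrite adj_lt ?(corner_lt_leaf fits) // no //.
  by rewrite 2!in_setU imset_f.
- move=> _ /imsetP[a _ ->]; rewrite adj_lt ?(corner_lt_leaf fits) // no //.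
  by rewrite 2!in_setU [X in _ || X || _]imset_f ?orbT.
have lt_no (a b : 'I_s) : (a < b)%N -> ~~ adj g (chosen n x a) (chosen n x b).
  move=> ab; rewrite adj_lt ?(leaf_lt fits) // no //.
  rewrite in_setU; apply/orP; right; apply/imsetP; exists (a, b) => //.
  by rewrite inE.
move=> _ _ /imsetP[a _ ->] /imsetP[b _ ->].
(* The pattern forbids increasing pairs of leaves only; symmetry of [adj] gives the reverse
   order. *)
case: (ltngtP a b) => [/lt_no//|/lt_no|/val_inj ->]; first by rewrite adj_sym.
by rewrite adj_irr.
Qed.

(** The two weights are convertible, so only the indicator needs a case distinction. *)
Lemma PnpE n (p : R) (E : rel 'I_n -> Prop) :
  Pnp p E = \sum_(g : {ffun 'I_n * 'I_n -> bool})
              graph_weight p g * (decb (E (adj g)))%:R.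
Proof.
apply: eq_bigr => g _; rewrite /indR /decb.
by case: ClassicalEpsilon.excluded_middle_informative.
Qed.

Lemma Pnp_le n (p : R) (E E' : rel 'I_n -> Prop) : 0 < p -> p < 1 ->
  (forall a, E a -> E' a) -> Pnp p E <= Pnp p E'.
Proof.
move=> p_gt0 p_lt1 EE'; rewrite !PnpE; apply: ler_sum => g _.
apply: ler_wpM2l; first exact: graph_weight_ge0.
rewrite ler_nat /decb; case: ClassicalEpsilon.excluded_middle_informative => // Ea.
by case: ClassicalEpsilon.excluded_middle_informative => // -[]; apply: EE'.
Qed.

(** The numerical hypothesis is the bound of [overlap_sum] divided by the square of the number t M^s
    of candidates, with c + M - 1 relaxed to c + M. *)
Lemma star_probability (n t s M : nat) (p Y : R) :
    (0 < t)%N -> (0 < M)%N -> (3 * t + s * M <= n)%N -> 0 < p -> p < 1 -> 0 <= Y ->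
    (forall l d, (l <= s)%N -> (2 * d <= l * l.-1)%N -> (1 - p) ^- d <= Y ^+ l) ->
    (1 + Y / M%:R) ^+ s
      + (t%:R * p ^+ 3)^-1 * (1 + Y / (M%:R * p * (1 - p) ^+ 2)) ^+ s < 3 / 2 ->
  1 / 2 < Pnp p (@event_u' 2 n s.+3).
Proof.
(* The vertices are built with [inord], which needs a successor; n = 0 contradicts [0 < t]. *)
move=> t_gt0 M_gt0; case: n => [|n] fits p_gt0 p_lt1 Y_ge0 hY small; first by lia.
rewrite PnpE.
apply: (@second_moment _ _ p ('I_t * {ffun 'I_s -> 'I_M})%type
  (@present n t s M) (@absent n t s M) (fun g => decb (event_u' 2 s.+3 (adj g)))) => //.
- by rewrite card_prod card_ffun !card_ord muln_gt0 t_gt0 expn_gt0 M_gt0.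
- exact: present_canonical.
- exact: absent_canonical.
- exact: present_absent_disjoint.
- move=> x g /(star_of_pattern fits) ev; rewrite /decb.
  by case: ClassicalEpsilon.excluded_middle_informative.
apply: le_lt_trans (overlap_sum fits p_gt0 p_lt1 hY) _.
rewrite card_prod card_ffun !card_ord natrM natrX [X in _ < _ * X]exprMn.
have m_gt0 : 0 < M%:R :> R by rewrite ltr0n.
have r_gt0 : 0 < t%:R :> R by rewrite ltr0n.
have q_gt0 : 0 < 1 - p by lra.
have scale_pos : 0 < t%:R ^+ 2 * (M%:R ^+ s) ^+ 2 :> R by rewrite mulr_gt0 ?exprn_gt0.
rewrite -(ltr_pM2l scale_pos) in small.
rewrite [X in _ < X]mulrC.
apply: le_lt_trans small; rewrite [leRHS]mulrDr.
have bnd (c : R) : 0 <= c ->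
    (M%:R * (c + M%:R - 1)) ^+ s <= (M%:R ^+ s) ^+ 2 * (1 + c / M%:R) ^+ s.
  move=> c0; rewrite -exprM mulnC exprM -exprMn; apply: lerXn2r.
  - rewrite nnegrE; apply: mulr_ge0; first exact: ltW.
    by have : 1 <= M%:R :> R by [rewrite ler1n]; lra.
  - rewrite nnegrE; apply: mulr_ge0; first exact: exprn_ge0 (ltW m_gt0).
    by rewrite addr_ge0 // divr_ge0 // ltW.
  have -> : M%:R ^+ 2 * (1 + c / M%:R) = M%:R * (c + M%:R) by field; rewrite gt_eqF.
  by apply: ler_wpM2l; [exact: ltW|lra].
apply: lerD.
  by rewrite -[leLHS]mulr_natl natrX -[leRHS]mulrA ler_wpM2l ?bnd // exprn_ge0 // ltW.
have c0 : 0 <= Y / (p * (1 - p) ^+ 2).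
  by rewrite divr_ge0 // ltW // mulr_gt0 // exprn_gt0.
rewrite -[leLHS]mulr_natl mulrA.
apply: le_trans (ler_wpM2l _ (bnd _ c0)) _.
  by rewrite mulr_ge0 ?ler0n // invr_ge0 exprn_ge0 // ltW.
rewrite le_eqVlt; apply/orP; left; apply/eqP.
have -> : Y / (M%:R * p * (1 - p) ^+ 2) = Y / (p * (1 - p) ^+ 2) / M%:R.
  by field; rewrite !gt_eqF.
by move: (_ ^+ s) => Z; move: (_ ^+ s) => Z'; field; rewrite !gt_eqF.
Qed.

(** * Asymptotics *)

Delimit Scope R_scope with R.
Local Open Scope R_scope.

(** Restated with the Stdlib operations, in which [ln] and [exp] are handled below. *)
Lemma star_probability_R (n t s M : nat) (p Y : R) :
    (0 < t)%N -> (0 < M)%N -> (3 * t + s * M <= n)%N -> 0 < p -> p < 1 -> 0 <= Y ->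
    (forall l d, (l <= s)%N -> (2 * d <= l * l.-1)%N -> / (1 - p) ^ d <= Y ^ l) ->
    (1 + Y / INR M) ^ s
      + / (INR t * p ^ 3) * (1 + Y / (INR M * p * (1 - p) ^ 2)) ^ s < 3 / 2 ->
  1 / 2 < Pnp p (@event_u' 2 n s.+3).
Proof.
move=> t0 M0 fits /RltP p0 /RltP p1 /RleP Y0 hY /RltP small.
apply/RltP; rewrite !RdivE.
apply: (@star_probability n t s M p Y) => //.
  by move=> l d ls dl; apply/RleP; rewrite -!RpowE; apply: hY.
by rewrite !RpowE !INRE !RdivE in small.
Qed.

(** * Elementary bounds for exp and ln *)

Lemma ln_le_sub1 y : 0 < y -> ln y <= y - 1.
Proof.
move=> y0; have := exp_ineq1_le (ln y); rewrite exp_ln //; Lra.lra.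
Qed.

Lemma pow_le_exp u k : 0 <= u -> (1 + u) ^ k <= exp (INR k * u).
Proof.
move=> u0; elim: k => [|k IH]; first by rewrite Rmult_0_l exp_0 /=; Lra.lra.
rewrite S_INR Rmult_plus_distr_r Rmult_1_l (Rplus_comm (INR k * u)) exp_plus /=.
apply: Rmult_le_compat => //; try Lra.lra; first by apply: pow_le; Lra.lra.
exact: exp_ineq1_le.
Qed.

Lemma exp_mul_INR k u : exp (INR k * u) = exp u ^ k.
Proof.
elim: k => [|k IH]; first by rewrite Rmult_0_l exp_0.
by rewrite S_INR Rmult_plus_distr_r Rmult_1_l (Rplus_comm (INR k * u)) exp_plus IH.
Qed.

Lemma exp_ge_pow k u : 0 <= u -> (u / INR k.+1) ^ k.+1 <= exp u.
Proof.
move=> u0; have k0 : 0 < INR k.+1 by apply: lt_0_INR; lia.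
have v0 : 0 <= u / INR k.+1 by apply: Rmult_le_pos => //; apply/Rlt_le/Rinv_0_lt_compat.
have -> : exp u = exp (u / INR k.+1) ^ k.+1.
  by rewrite -exp_mul_INR; congr exp; rewrite /Rdiv -Rmult_assoc Rinv_r_simpl_m //; Lra.lra.
by apply: pow_incr; split=> //; have := exp_ineq1_le (u / INR k.+1); Lra.lra.
Qed.

(** Used with x = ln n: the first bound yields t p^3 >= 10, the second 4 s <= n, the third 10 s Y <=
    M p q^2. *)
Lemma exp_eventually_dominates c : 0 < c ->
  exists X, forall x, X <= x ->
    [/\ 480 <= x, 12 * x <= exp (3 / 4 * x) & 360 * x ^ 4 <= exp (c * x)].
Proof.
move=> c0; have c5 : 0 < c ^ 5 by apply: pow_lt.
have ic5 : 0 < / c ^ 5 by apply: Rinv_0_lt_compat.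
(* The constant is 360 * 5^5, since exp (c x) is bounded below by (c x / 5)^5. *)
exists (480 + 1125000 * / c ^ 5) => x hx; have x480 : 480 <= x by Lra.lra.
split=> //.
  have := @exp_ge_pow 1 (3 / 4 * x) ltac:(Lra.lra).
  rewrite /=; Lra.nra.
apply: Rle_trans (@exp_ge_pow 4 (c * x) _); last by apply: Rmult_le_pos; Lra.lra.
have -> : (c * x / INR 5) ^ 5 = (c ^ 5 * x / 3125) * x ^ 4 by rewrite /=; Lra.lra.
apply: Rmult_le_compat_r; first by apply: pow_le; Lra.lra.
have : c ^ 5 * (1125000 * / c ^ 5) <= c ^ 5 * x by apply: Rmult_le_compat_l; Lra.lra.
have -> : c ^ 5 * (1125000 * / c ^ 5) = 1125000.
  by rewrite (Rmult_comm 1125000) -Rmult_assoc Rinv_r ?Rmult_1_l; Lra.lra.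
Lra.lra.
Qed.

(** The quantitative core: the asymptotic conditions enter as p >= n^(-1/4) and q ln n > 1, and the
    threshold X depends on eps alone. *)
Lemma likely_star (eps : R) : 0 < eps ->
  exists X, forall n (p : R), X <= ln (INR n) -> exp (- (ln (INR n) / 4)) <= p ->
    0 < 1 - p -> 1 < (1 - p) * ln (INR n) ->
    let bound := (2 - eps + 4 * ln p / ln (INR n * p))
                 * logb (1 / (1 - p)) (INR n * p) in
    0 < bound ->
  exists2 s : nat, bound <= INR s & (s.+3 <= n)%N /\ 1 / 2 < Pnp p (@event_u' 2 n s.+3).
Proof.
move=> eps0; have [X hX] := @exp_eventually_dominates (3 / 8 * eps) ltac:(Lra.lra).
exists X => n p.
case: (posnP n) => [->|n0].
  (* Stdlib gives [ln 0] the value 0, which is below the threshold 480. *)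
  have -> : ln (INR 0) = 0.
    by unfold ln; destruct (Rlt_dec 0 (INR 0)) as [h|h] => //; case: (Rlt_irrefl _ h).
  by move=> /hX[]; Lra.lra.
set x := ln (INR n) => /hX[x480 x12 x4] p_ge q0 qx bound bound0.
have nR0 : 0 < INR n by apply: lt_0_INR; lia.
have nE : INR n = exp x by rewrite exp_ln.
have p0 : 0 < p by apply: Rlt_le_trans p_ge; apply: exp_pos.
have lnp_ge : - (x / 4) <= ln p 
  by apply: Rnot_lt_le => /exp_increasing; rewrite exp_ln //; Lra.lra.
have lnp_le : ln p <= 0 by have := ln_le_sub1 p0; Lra.lra.
have LE : ln (INR n * p) = x + ln p by rewrite ln_mult.
set lam := ln (1 / (1 - p)).
have lamE : lam = - ln (1 - p) by rewrite /lam /Rdiv Rmult_1_l ln_Rinv.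
have lam_ge : p <= lam by rewrite lamE; have := ln_le_sub1 q0; Lra.lra.
(* As lam = - ln q, exp B is q^(-bound). *)
pose B := (2 - eps) * (x + ln p) + 4 * ln p.
have boundE : bound * lam = B.
  rewrite /bound /logb LE. rewrite -/lam /B /Rdiv; set L := x + ln p.
  have L1 : / L * L = 1 by apply: Rinv_l; rewrite /L; Lra.lra.
  have lam1 : / lam * lam = 1 by apply: Rinv_l; Lra.lra.
  transitivity (((2 - eps) * L + 4 * ln p * (/ L * L)) * (/ lam * lam)); first by Lra.lra.
  by rewrite L1 lam1; Lra.lra.
have Bx : B <= 2 * x by rewrite /B; Lra.nra.
have bound_p : bound * p <= 2 * x by Lra.nra.
(* [up bound] is the floor plus one, so s - 1 <= bound < s. *)
pose s := Z.to_nat (up bound).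
have [up1 up2] := archimed bound.
have sE : INR s = IZR (up bound).
  by rewrite INR_IZR_INZ Z2Nat.id //; apply: le_IZR; Lra.lra.
have s_gt : bound < INR s by rewrite sE.
have s_le : INR s <= bound + 1 by Lra.lra.
have s0 : (0 < s)%N by apply/ssrnat.ltP/INR_lt; rewrite /=; Lra.lra.
have sp : INR s * p <= 3 * x by Lra.nra.
have n12 : (12 <= n)%N.
  apply/ssrnat.leP/INR_le; rewrite nE; have := exp_ineq1_le x; rewrite /=; Lra.lra.
(* 4 s p <= 12 x <= n^(3/4) <= n p. *)
have s4n : (4 * s <= n)%N.
  apply/ssrnat.leP/INR_le; rewrite -multE mult_INR /=.
  apply: (Rmult_le_reg_r p) => //.
  have nE4 : exp (3 / 4 * x) * exp (x / 4) = INR n.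
    by rewrite -exp_plus nE; congr exp; Lra.lra.
  have pE4 : 1 <= exp (x / 4) * p.
    apply: Rle_trans (Rmult_le_compat_l _ _ _ (Rlt_le _ _ (exp_pos (x / 4))) p_ge).
    by rewrite -exp_plus Rplus_opp_r exp_0; Lra.lra.
  have : exp (3 / 4 * x) * 1 <= exp (3 / 4 * x) * (exp (x / 4) * p).
    by apply: Rmult_le_compat_l pE4; apply/Rlt_le/exp_pos.
  by rewrite -Rmult_assoc nE4; Lra.lra.
(* Triangles and leaf blocks get at most half of the vertices each; each rounding down loses at most
   a factor 2. *)
pose t := (n %/ 6)%N; pose M := (n %/ (2 * s))%N.
have nt : (n <= 12 * t)%N by rewrite /t; lia.
have nM : (n <= 4 * s * M)%N.
  have := divn_eq n (2 * s); have := ltn_pmod n (_ : 0 < 2 * s)%N; rewrite -/M; nia.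
have M0 : (0 < M)%N by nia.
have t0 : (0 < t)%N by lia.
have fits : (3 * t + s * M <= n)%N.
  have := leq_divM n 6; have := leq_divM n (2 * s); rewrite -/M -/t; nia.
have ntR : INR n <= 12 * INR t.
  by move/ssrnat.leP/le_INR: nt; rewrite -multE mult_INR /=; Lra.lra.
have nMR : INR n <= 4 * INR s * INR M.
  by move/ssrnat.leP/le_INR: nM; rewrite -!multE !mult_INR /=; Lra.lra.
exists s; first exact: Rlt_le.
split; first by nia.
pose Y := exp (B / 2).
have Y0 : 0 < Y by apply: exp_pos.
have hY l d : (l <= s)%N -> (2 * d <= l * l.-1)%N -> / (1 - p) ^ d <= Y ^ l.
  move=> ls dl.
  have -> : 1 - p = exp (- lam) by rewrite lamE Ropp_involutive exp_ln.
  rewrite -exp_mul_INR -exp_Ropp /Y -exp_mul_INR -boundE.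
  (* For l > 0, 2 d <= l (l - 1) and l - 1 <= s - 1 <= bound. *)
  have d_le : 2 * INR d <= INR l * bound.
    case: l ls dl => [|l] ls /ssrnat.leP/le_INR; rewrite -!multE !mult_INR /=; first Lra.lra.
    have : INR l + 1 <= INR s by rewrite -S_INR; apply/le_INR/ssrnat.leP.
    have := pos_INR l; move: (S_INR l) => /= ->; Lra.nra.
  have : - (INR d * - lam) <= INR l * (bound * lam / 2) by Lra.nra.
  by case=> [lt|->]; [left; apply: exp_increasing|right].
have MR0 : 0 < INR M by apply: lt_0_INR; lia.
have tR0 : 0 < INR t by apply: lt_0_INR; lia.
have sR0 : 0 < INR s by apply: lt_0_INR; lia.
have p1 : p <= 1 by Lra.nra.
have p3E : exp (- (3 / 4 * x)) <= p ^ 3.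
  have -> : - (3 / 4 * x) = INR 3 * (- (x / 4)) by rewrite /=; Lra.lra.
  by rewrite exp_mul_INR; apply: pow_incr; split=> //; apply/Rlt_le/exp_pos.
(* 12 t p^3 >= n p^3 >= n^(1/4) >= 1 + x/4 >= 121. *)
have tp3 : 10 <= INR t * p ^ 3.
  have : INR n * exp (- (3 / 4 * x)) <= 12 * INR t * p ^ 3.
    by apply: Rmult_le_compat => //; [Lra.lra|apply/Rlt_le/exp_pos].
  rewrite nE -exp_plus.
  have -> : x + - (3 / 4 * x) = x / 4 by Lra.lra.
  by have := exp_ineq1_le (x / 4); Lra.lra.
(* Y = n p^3 (np)^(-eps/2), and np >= n^(3/4) bounds the last factor by exp (-3/8 eps x); hence the
   constant 3/8 in the choice of X. *)
have Yn : 360 * x ^ 4 * Y <= INR n * p ^ 3.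
  have -> : INR n * p ^ 3 = exp (x + 3 * ln p).
    rewrite exp_plus -nE; congr (_ * _).
    by rewrite -{1}(exp_ln p p0) -exp_mul_INR; congr exp; rewrite /=; Lra.lra.
  apply: Rle_trans (Rmult_le_compat_r _ _ _ (Rlt_le _ _ Y0) x4) _.
  rewrite /Y -exp_plus; have e : 3 / 8 * eps * x + B / 2 <= x + 3 * ln p.
    have : 0 <= eps * (x / 4 + ln p) by apply: Rmult_le_pos; Lra.lra.
    by rewrite /B; Lra.lra.
  by case: e => [e|->]; [left; apply: exp_increasing|right].
(* As M >= n/(4s), it suffices that 40 s^2 Y <= n p q^2. After multiplication by p^2 x^2, the left
   side is at most 360 x^4 Y because s p <= 3 x, and the right side is at least n p^3 because q x >
   1. *)
have main : 10 * (INR s * Y) <= INR M * p * (1 - p) ^ 2.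
  have P1 : (INR s * p) * (INR s * p) <= 9 * (x * x).
    have sp0 : 0 <= INR s * p by apply: Rmult_le_pos; Lra.lra.
    by have := Rmult_le_compat _ _ _ _ sp0 sp0 sp sp; Lra.lra.
  have Q1 : 1 <= ((1 - p) * x) * ((1 - p) * x) by Lra.nra.
  have pos1 : 0 < p ^ 2 * x ^ 2 * INR s.
    by apply: Rmult_lt_0_compat => //; apply: Rmult_lt_0_compat; apply: pow_lt; Lra.lra.
  apply: (Rmult_le_reg_r (4 * (p ^ 2 * x ^ 2 * INR s))); first by Lra.lra.
  have step1 : 40 * (x * x) * Y * ((INR s * p) * (INR s * p)) <= 40 * (x * x) * Y * (9 * (x * x)).
    by apply: Rmult_le_compat_l P1; apply: Rmult_le_pos; Lra.nra.
  have np3 : 0 <= INR n * p ^ 3.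
    by apply: Rmult_le_pos; [Lra.lra|apply: pow_le; Lra.lra].
  have step2 : INR n * p ^ 3 * 1 <= INR n * p ^ 3 * (((1 - p) * x) * ((1 - p) * x)).
    by apply: Rmult_le_compat_l Q1.
  have step3 : INR n * (p ^ 3 * (((1 - p) * x) * ((1 - p) * x)))
      <= 4 * INR s * INR M * (p ^ 3 * (((1 - p) * x) * ((1 - p) * x))).
    apply: Rmult_le_compat_r nMR; apply: Rmult_le_pos; last by Lra.lra.
    by apply: pow_le; Lra.lra.
  by rewrite /= in step1 step2 step3 Yn *; Lra.lra.
have D0 : 0 < INR M * p * (1 - p) ^ 2.
  by apply: Rmult_lt_0_compat; [apply: Rmult_lt_0_compat|apply: pow_lt].
have pq1 : p * (1 - p) ^ 2 <= 1 by rewrite /=; Lra.nra.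
(* (1 + Y/D)^s <= exp (s Y / D) <= exp (1/10) <= 1/(1 - 1/10). *)
have power_le D : 0 < D -> 10 * (INR s * Y) <= D -> (1 + Y / D) ^ s <= 10 / 9.
  move=> Dp hD; apply: Rle_trans (pow_le_exp s _) _.
    by apply: Rmult_le_pos; [Lra.lra|apply/Rlt_le/Rinv_0_lt_compat].
  have h : INR s * (Y / D) <= 1 / 10.
    apply: (Rmult_le_reg_r D) => //.
    by rewrite /Rdiv -Rmult_assoc Rmult_assoc Rinv_l; Lra.lra.
  have h2 := exp_ineq1_le (- (INR s * (Y / D))).
  have h3 : exp (INR s * (Y / D)) * exp (- (INR s * (Y / D))) = 1.
    by rewrite -exp_plus Rplus_opp_r exp_0.
  by have := exp_pos (INR s * (Y / D)); Lra.nra.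
have pow1 : (1 + Y / INR M) ^ s <= 10 / 9.
  by apply: power_le => //; Lra.nra.
have pow2 := power_le _ D0 main.
have it : / (INR t * p ^ 3) <= 1 / 10.
  by rewrite /Rdiv Rmult_1_l; apply: Rinv_le_contravar; Lra.lra.
have it0 : 0 < / (INR t * p ^ 3) by apply: Rinv_0_lt_compat; Lra.lra.
have prod := Rmult_le_compat_l _ _ _ (Rlt_le _ _ it0) pow2.
(* The total is at most 10/9 + 1/10 * 10/9 = 11/9 < 3/2. *)
by apply: (@star_probability_R n t s M p Y) => //; Lra.lra.
Qed.

(** * Lower bounds for [u_d] and [u_d'] *)

Lemma le_INR_max (n k : nat) (P : pred nat) (b : R) : (k <= n)%N -> P k -> b <= INR k ->
  b <= INR (\max_(j < n.+1 | P j) j).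
Proof.
move=> kn Pk bk; apply: Rle_trans bk _; apply/le_INR/ssrnat.leP.
by have kn1 : (k < n.+1)%N by []; apply: (leq_bigmax_cond (Ordinal kn1)).
Qed.

Theorem theorem17 (p : nat -> R)
  (hp : forall n, (0 <= p n <= 1)%R)
  (h1 : cv_infty (fun n => (p n * Rpower (INR n) (1/4) / ln (INR n))%R))
  (h2 : cv_infty (fun n => ((1 - p n) * ln (INR n))%R)) :
  forall eps : R, (0 < eps)%R ->
  exists n0 : nat, forall n : nat, (n0 <= n)%N ->
    let bound := ((2 - eps + 4 * ln (p n) / ln (INR n * p n))
                  * logb (1 / (1 - p n)) (INR n * p n))%R in
    (bound <= INR (u_d 2 n (p n)))%R /\ (bound <= INR (u_d' 2 n (p n)))%R.
Proof.
move=> eps eps0; have [X hX] := likely_star eps0.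
have [N1 hN1] := h1 1; have [N2 hN2] := h2 1.
have [N3 hN3] := INR_archimed 1 (exp (Rmax X 1)) Rlt_0_1.
exists (maxn N3 (maxn N1 N2)) => n; rewrite !geq_max => /and3P[n3 n1 n2] bound.
(* A nonpositive bound holds trivially, as both quantities are natural numbers. *)
have [b0|b0] := Rle_lt_dec bound 0.
  by split; apply: Rle_trans b0 (pos_INR _).
have nX : Rmax X 1 < ln (INR n).
  rewrite -[X in X < _]ln_exp; apply: ln_increasing; first exact: exp_pos.
  by apply: Rlt_le_trans hN3 _; rewrite Rmult_1_r; apply/le_INR/ssrnat.leP.
have := Rmax_l X 1; have := Rmax_r X 1 => max1 maxX.
have big := hN1 n (elimT ssrnat.leP n1); have qx := hN2 n (elimT ssrnat.leP n2).
have q0 : 0 < 1 - p n by have := hp n; Lra.nra.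
(* The first limit gives p n^(1/4) > ln n, and ln n > 1. *)
have p_ge : exp (- (ln (INR n) / 4)) <= p n.
  have e0 := exp_pos (ln (INR n) / 4).
  have inv : exp (- (ln (INR n) / 4)) * exp (ln (INR n) / 4) = 1.
    by rewrite -exp_plus Rplus_opp_l exp_0.
  apply: (Rmult_le_reg_r (exp (ln (INR n) / 4))) => //; rewrite inv.
  have -> : exp (ln (INR n) / 4) = Rpower (INR n) (1 / 4).
    by rewrite /Rpower; congr exp; Lra.lra.
  have lnn0 : 0 < ln (INR n) by Lra.lra.
  have := Rmult_lt_compat_r _ _ _ lnn0 big.
  by rewrite /Rdiv Rmult_assoc Rinv_l; Lra.lra.
have p0 : 0 < p n by apply: Rlt_le_trans p_ge; apply: exp_pos.
have p1 : p n < 1 by Lra.lra.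
have [s bs [sn prob]] := hX n (p n) ltac:(Lra.lra) p_ge q0 qx b0.
have bk : bound <= INR s.+3 by apply: Rle_trans bs _; apply: le_INR; lia.
have ltkn : (s.+3 <= n)%N := sn.
split.
  (* The star found is connected; for [u_d] that part of the event is dropped by monotonicity. *)
  apply: (le_INR_max (P := fun k => (0 < k)%N && decb (Pnp (p n) (event_u 2 k) > 1/2))) ltkn _ bk.
  rewrite /decb /=; case: ClassicalEpsilon.excluded_middle_informative => // -[].
  apply: Rlt_le_trans prob _; apply/RleP; apply: Pnp_le; try exact/RltP.
  by move=> a [W [cW [dW [chW _]]]]; exists W.
apply: (le_INR_max (P := fun k => (0 < k)%N && decb (Pnp (p n) (event_u' 2 k) > 1/2))) ltkn _ bk.
by rewrite /decb /=; case: ClassicalEpsilon.excluded_middle_informative.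
Qed.
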